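(* Let $N$ be a non-negative integer-valued random variable defined on a probability space $(\Omega,\mathcal{F},\mathbb{P})$ with $\mathbb{P}(N=0)<1$, and, on the same space, let $X_1,X_2,\ldots$ be a sequence of i.i.d. $k$-dimensional real random vectors, $X_i=(X_{i,1},\ldots,X_{i,k})^\top$, with finite mean, independent of $N$, such that $\sum_{\ell=1}^kX_{i,\ell}=1$. Let $S_N^{(\ell)}:=\sum_{i=1}^NX_{i,\ell}$ and suppose that $S_N^{(1)},\ldots,S_N^{(k)}$ are independent. (a) If $X_1\sim\mathrm{Categorical}(p_1,\ldots,p_k)$ with $p_\ell\in(0,1)$ for some $\ell$, then $N\sim\mathrm{Poisson}(\lambda)$ for some $\lambda>0$. (b) If $N\sim\mathrm{Poisson}(\lambda)$ for some $\lambda>0$, then $X_1\sim\mathrm{Categorical}(p_1,\ldots,p_k)$ for some $p_1,\ldots,p_k\in[0,1]$ adding up to $1$.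
   Context: $\mathrm{Categorical}(p_1,\ldots,p_k)$ (with $p_\ell\ge0$, $\sum_\ell p_\ell=1$) is the multinomial law with a single trial: the random vector equals the $\ell$-th standard basis vector of $\mathbb{R}^k$ with probability $p_\ell$. ''Independent of $N$'' means that $N$ is independent of the whole sequence $(X_i)_{i\ge1}$. An empty sum is $0$. *)

(* Defs.v *)
From mathcomp Require Import all_boot all_order all_algebra finmap.
From mathcomp Require Import all_classical all_reals all_analysis.

Set Implicit Arguments.
Unset Strict Implicit.
Unset Printing Implicit Defensive.

Import Order.TTheory GRing.Theory Num.Theory.
Import numFieldNormedType.Exports.

Local Open Scope classical_set_scope.
Local Open Scope ring_scope.

(* Random vectors of R^k are random variables with values in k.-tuple R, whose
   measurable sets are the sigma-algebra generated by the k coordinates of the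
   Borel line, that is, the Borel sets of R^k. *)

Section Independence.
Context {d d' : measure_display} {T : measurableType d} {T' : measurableType d'}.
Context {R : realType} (P : probability T R).

(* Mutual independence of a possibly infinite family: the product rule over
   every finite subfamily. *)
Definition mutually_independent (I : choiceType) (Y : I -> T -> T') : Prop :=
  forall (J : {fset I}) (A : I -> set T'),
    (forall i, measurable (A i)) ->
    P (\bigcap_(i in [set` J]) (Y i @^-1` A i)) =
    (\prod_(i <- J) P (Y i @^-1` A i))%E.

(* On non-measurable sets the value of P carries no meaning. *)
Definition identically_distributed (I : Type) (Y : I -> {RV P >-> T'}) : Prop :=
  forall (i j : I) (A : set T'),
    measurable A -> distribution P (Y i) A = distribution P (Y j) A.

Definition iid (I : choiceType) (Y : I -> {RV P >-> T'}) : Prop :=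
  mutually_independent Y /\ identically_distributed Y.

Definition sigma_family (I : Type) (Y : I -> T -> T') : set (set T) :=
  <<s \bigcup_(i in [set: I]) preimage_set_system setT (Y i) measurable >>.

Definition independent_of_family (d'' : measure_display)
    (T'' : measurableType d'') (Z : T -> T'') (I : Type) (Y : I -> T -> T') :
    Prop :=
  forall (B : set T'') (E : set T), measurable B -> sigma_family Y E ->
    P (Z @^-1` B `&` E) = (P (Z @^-1` B) * P E)%E.

End Independence.

Section Laws.
Context {d : measure_display} {T : measurableType d}.
Context {R : realType} (P : probability T R).

Definition std_basis (k : nat) (l : 'I_k) : k.-tuple R :=
  [tuple (j == l)%:R | j < k].

Definition prob_vector (k : nat) (p : 'I_k -> R) : Prop :=
  (forall l, 0 <= p l) /\ \sum_(l < k) p l = 1.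

Definition categorical_law (k : nat) (X : {RV P >-> k.-tuple R})
    (p : 'I_k -> R) : Prop :=
  prob_vector p /\ forall l : 'I_k, distribution P X [set std_basis l] = (p l)%:E.

Definition poisson_law (N : {RV P >-> nat}) (lambda : R) : Prop :=
  forall n : nat, distribution P N [set n] = (poisson_pmf lambda n)%:E.

(* S_N^(l); X_1, X_2, ... are X 0, X 1, ... *)
Definition random_sum (k : nat) (N : T -> nat) (X : nat -> T -> k.-tuple R)
    (l : 'I_k) (w : T) : R :=
  \sum_(i < N w) tnth (X i w) l.

End Laws.

(* Main.v *)
Require Import Defs.
From mathcomp Require Import all_boot all_order all_algebra finmap.
From mathcomp Require Import ring.
From mathcomp Require Import all_classical all_reals all_analysis.
Set Implicit Arguments.
Unset Strict Implicit.
Unset Printing Implicit Defensive.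
Import Order.TTheory GRing.Theory Num.Theory.
Import numFieldNormedType.Exports.
Local Open Scope classical_set_scope.
Local Open Scope ring_scope.

(** Both halves rest on the fact that the [k] components of the random sum almost
    surely add up to [N]. When the summands are standard basis vectors, [S_N^(l)]
    counts how many of the first [N] of them equal the [l]-th one.

    Categorical summands force a Poisson number of terms. Take two coordinates
    [l != m] of positive probability [p] and [r]. The event that [a] summands are
    of type [l], [b] of type [m] and none of any other type has probability
    [P(N = a + b) 'C(a + b, b) p^a r^b] ([two_type_count_law]), while independence
    makes it a product [F a * G b] ([thinned_count_factorizes]). Comparing [b = 0]
    with [b = 1] gives [(n + 1) P(N = n + 1) = lambda P(N = n)], where
    [lambda = G 1 / (r G 0)] is independent of [n], and this recursion
    together with total mass one is the Poisson law ([poisson_of_recursion]).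

    A Poisson number of terms forces categorical summands. Both [N = 0]
    and [N = 1] now have positive probability. As [N = 0] makes every
    component of the random sum vanish, each of them vanishes with positive
    probability; by independence, whatever values [S_N^(l)] takes, it takes while
    the other components are zero, and then it equals the total [N]. Hence each
    component is almost surely a natural number ([random_sum_nat]). On [N = 1] the
    random sum is [X_1], which is independent of that event, so the entries of
    [X_1] are natural numbers too ([summand_nat]); since they add up to [1],
    [X_1] is a standard basis vector. *)

(** * Measurability of finite combinations and of random sums *)

Section MeasurableSets.
Context {d : measure_display} {T : measurableType d} {R : realType}.

Lemma measurable_forall {I : finType} {F : I -> set T} :
  (forall i, measurable (F i)) -> measurable [set w | forall i, F i w].
Proof.
move=> mF; have -> : [set w | forall i, F i w] = \bigcap_(i in [set: I]) F i.
  by apply/seteqP; split => w Fw i //; exact: Fw.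
by apply: fin_bigcap_measurable => //; exact: finite_finset.
Qed.

Lemma measurable_exists {I : finType} {F : I -> set T} :
  (forall i, measurable (F i)) -> measurable [set w | exists i, F i w].
Proof.
move=> mF; have -> : [set w | exists i, F i w] = \bigcup_(i in [set: I]) F i.
  by apply/seteqP; split => w [i]; [exists i|move=> _ ?; exists i].
by apply: fin_bigcup_measurable => //; exact: finite_finset.
Qed.

Lemma measure_exists {I : finType} {F : I -> set T} (P : probability T R) :
  (forall i, measurable (F i)) -> (forall i j w, F i w -> F j w -> i = j) ->
  P [set w | exists i, F i w] = (\sum_i P (F i))%E.
Proof.
move=> mF disjF.
have -> : [set w | exists i, F i w] = \bigcup_(i in [set` index_enum I]) F i.
  apply/seteqP; split => w [i]; last by move=> _ ?; exists i.
  by exists i => //=; exact: mem_index_enum.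
rewrite measure_fin_bigcup//; first by rewrite -fsbig_seq ?index_enum_uniq.
by move=> i j _ _ [w [Fi Fj]]; exact: disjF Fi Fj.
Qed.

End MeasurableSets.

Lemma measurable_nat_set {R : realType} :
  measurable [set x : R | x \is a Num.nat].
Proof.
have -> : [set x : R | x \is a Num.nat] = \bigcup_n [set n%:R].
  apply/seteqP; split => [x /natrP[n ->]|_ [n _ ->] /=]; first by exists n.
  exact: natr_nat.
by apply: bigcupT_measurable => n; exact: measurable_set1.
Qed.

Lemma measurable_nonnat_set {R : realType} :
  measurable [set x : R | x \isn't a Num.nat].
Proof.
rewrite (_ : [set x | _] = ~` [set x : R | x \is a Num.nat]).
  by apply: measurableC; exact: measurable_nat_set.
by apply/seteqP; split => x /= /negP.
Qed.

Lemma measurable_tuple_set1 {R : realType} {k : nat} (x : k.-tuple R) :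
  measurable [set x].
Proof.
have -> : [set x] = [set y | forall l, tnth y l = tnth x l].
  by apply/seteqP; split => [_ -> //|y /eq_from_tnth].
apply: (measurable_forall (F := fun l => [set y | tnth y l = tnth x l])) => l.
rewrite -[X in measurable X]setTI.
exact: (measurable_tnth l measurableT (measurable_set1 (tnth x l))).
Qed.

(** A sum with a random number of terms is measurable because it agrees, on each
    of the countably many events [N = n], with a sum of fixed length. *)
Lemma measurable_random_sum {d : measure_display} {T : measurableType d}
    {R : realType} {k : nat} {P : probability T R} (N : {RV P >-> nat})
    (X : nat -> {RV P >-> k.-tuple R}) (l : 'I_k) :
  measurable_fun setT (random_sum N X l).
Proof.
move=> _ Y mY; rewrite setTI.
have -> : random_sum N X l @^-1` Y = \bigcup_n (N @^-1` [set n] `&`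
    (fun w => \sum_(i < n) tnth (X i w) l) @^-1` Y).
  by apply/seteqP; split => [w Yw|w [n _ [/= Nw]]];
    [exists (N w)|rewrite /random_sum /= Nw].
apply: bigcupT_measurable => n; apply: measurableI.
  exact: measurable_funPTI.
rewrite -[_ @^-1` _]setTI; apply: measurable_sum => // i.
exact: (measurableT_comp (measurable_tnth l) (measurable_funPT (X i))).
Qed.

(** * Product rules for independent families *)

Section FiniteIndependence.
Context {d d' : measure_display} {T : measurableType d} {T' : measurableType d'}.
Context {R : realType} (P : probability T R).

Lemma mutually_independent_seq {I : choiceType} {Y : I -> T -> T'} {s : seq I}
    {A : I -> set T'} :
  mutually_independent P Y -> uniq s -> (forall i, measurable (A i)) ->
  P (\bigcap_(i in [set` s]) (Y i @^-1` A i)) =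
  (\prod_(i <- s) P (Y i @^-1` A i))%E.
Proof.
move=> indY us mA.
have [J Js Jperm] : exists2 J : {fset I}, J =i s & perm_eq J s.
  exists (seq_fset tt s); first exact: seq_fsetE.
  by have := seq_fset_perm tt s; rewrite undup_id.
have -> : [set` s] = [set` J] by apply/seteqP; split => i; rewrite /mkset Js.
by rewrite indY//; exact: perm_big.
Qed.

Lemma mutually_independent_all {I : finType} {Y : I -> T -> T'}
    {A : I -> set T'} :
  mutually_independent P Y -> (forall i, measurable (A i)) ->
  P [set w | forall i, A i (Y i w)] = (\prod_i P (Y i @^-1` A i))%E.
Proof.
move=> indY mA.
rewrite -[in RHS]big_enum/= -(mutually_independent_seq indY) ?enum_uniq//.
congr (P _); apply/seteqP; split => [w Aw i _|w Aw i]; first exact: Aw.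
by apply: Aw => /=; rewrite mem_enum.
Qed.

Lemma measurable_count_sample {N : {RV P >-> nat}} {X : nat -> {RV P >-> T'}}
    {n : nat} {B : 'I_n -> set T'} : (forall i, measurable (B i)) ->
  measurable [set w | N w = n /\ forall i : 'I_n, B i (X i w)].
Proof.
move=> mB; apply: (measurableI (N @^-1` [set n])).
  exact: measurable_funPTI.
apply: (measurable_forall (F := fun i : 'I_n => X i @^-1` B i)) => i.
exact: measurable_funPTI.
Qed.

(** The law of [N] together with the first [n] terms: independence from the whole
    sequence splits off [N], the product rule splits the terms, and equidistribution
    brings every factor back to the first term. *)
Lemma joint_law_count_sample {N : {RV P >-> nat}} {X : nat -> {RV P >-> T'}}
    {n : nat} {B : 'I_n -> set T'} :
  iid X -> independent_of_family P N X -> (forall i, measurable (B i)) ->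
  P [set w | N w = n /\ forall i : 'I_n, B i (X i w)] =
  (P (N @^-1` [set n]) * \prod_(i < n) P (X 0%N @^-1` B i))%E.
Proof.
move=> [indX idX] indN mB.
(* The conditions, indexed by ['I_n], are extended to all of [nat] by the
   trivial condition so that the product rule for the sequence applies. *)
pose A (i : nat) := oapp B setT (insub i).
have AE (i : 'I_n) : A i = B i by rewrite /A valK.
have mA i : measurable (A i) by rewrite /A; case: insub => //= ?; exact: mB.
have -> : [set w | N w = n /\ forall i : 'I_n, B i (X i w)] =
    N @^-1` [set n] `&` \bigcap_(i in [set` iota 0 n]) X i @^-1` A i.
  apply/seteqP; split => w [Nw] /= XB; split => // i; last first.
    by rewrite -AE; apply: XB; rewrite /= mem_iota ltn_ord.
  by rewrite /= mem_iota /= => ilt; have /= := XB (Ordinal ilt); rewrite -AE.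
rewrite indN//; last first.
  apply: (@bigcap_measurableType _ (g_sigma_algebraType _)).
  move=> i _; apply: sub_sigma_algebra; exists i => //.
  by exists (A i) => //; rewrite setTI.
congr (_ * _)%E.
rewrite (mutually_independent_seq indX) ?iota_uniq// -[n in iota 0 n]subn0.
rewrite -/(index_iota 0 n) big_mkord; apply: eq_bigr => i _.
by rewrite AE; exact: (idX i 0%N (B i) (mB i)).
Qed.

End FiniteIndependence.

(** * Standard basis vectors *)

Section StandardBasis.
Context {R : realType} {k : nat}.

Lemma std_basis_inj : injective (@std_basis R k).
Proof.
move=> l m /(congr1 (fun x => tnth x l)).
by rewrite !tnth_mktuple eqxx; case: eqVneq => // _ /eqP; rewrite oner_eq0.
Qed.

(** Natural numbers can only add up to [1] as one [1] and zeros. *)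
Lemma nat_tuple_sum1 (x : k.-tuple R) :
  (forall l, tnth x l \is a Num.nat) -> \sum_(l < k) tnth x l = 1 ->
  exists l, x = std_basis l.
Proof.
move=> natx sumx; pose f l := Num.truncn (tnth x l).
have xE l : tnth x l = (f l)%:R by rewrite truncnK.
have : \sum_(l < k) f l == 1%N.
  by rewrite -(eqr_nat R) natr_sum -(eq_bigr _ (fun l _ => xE l)) sumx mulr1n.
move/sum_nat_eq1 => [l [_ fl1 fother]]; exists l; apply: eq_from_tnth => m.
by rewrite xE tnth_mktuple; case: eqVneq => [->|/fother ->//]; rewrite fl1.
Qed.

End StandardBasis.

(** * Natural-valued components and summands *)

Section RandomSums.
Context {d : measure_display} {T : measurableType d} {R : realType}.
Context {P : probability T R} {k : nat}.
Context {N : {RV P >-> nat}} {X : nat -> {RV P >-> k.-tuple R}}.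

(** If [S_N^(l)] left the natural numbers with positive probability, then by
    independence it would do so with positive probability while all the other
    components are [0], which they are at least when [N = 0]. But then [S_N^(l)]
    is the sum of all the components, that is, [N]. *)
Lemma random_sum_nat :
  P (N @^-1` [set 0%N]) != 0%E ->
  (forall i : nat, {ae P, forall w, \sum_(l < k) tnth (X i w) l = 1}) ->
  mutually_independent P (random_sum N X) ->
  forall l, P (random_sum N X l @^-1` [set x | x \isn't a Num.nat]) = 0%E.
Proof.
move=> N0 /ae_foralln hsum hS l; apply/eqP; apply: contraT => Pl.
have mS := measurable_random_sum N X.
pose A m : set R := if m == l then [set x | x \isn't a Num.nat] else [set 0].
have mA m : measurable (A m).
  rewrite /A; case: ifP => _; last exact: measurable_set1.
  exact: measurable_nonnat_set.
have mSA m : measurable (random_sum N X m @^-1` A m).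
  by rewrite -[X in measurable X]setTI; apply: mS.
have : P [set w | forall m, A m (random_sum N X m w)] != 0%E.
  rewrite (mutually_independent_all hS)//.
  apply: (big_ind (fun x : \bar R => x != 0%E)) => [||m _].
  - by rewrite onee_neq0.
  - by move=> x y; exact: mule_neq0.
  - rewrite /A; have [->//|_] := eqVneq m l.
    move: N0; rewrite -!measure_gt0 => /lt_le_trans; apply.
    apply: le_measure; rewrite ?inE.
    + exact: measurable_funPTI.
    + by rewrite -[X in measurable X]setTI; apply: mS.
    + by move=> w /= Nw; rewrite /random_sum Nw big_ord0.
rewrite measure_negligible ?eqxx//; first exact: measurable_forall.
apply: negligibleS hsum => w /= Aw sumX.
have /negP[] : random_sum N X l w \isn't a Num.nat.
  by have := Aw l; rewrite /A eqxx.
suff -> : random_sum N X l w = (N w)%:R by exact: natr_nat.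
have <- : \sum_m random_sum N X m w = (N w)%:R.
  rewrite exchange_big/=; under eq_bigr do rewrite sumX.
  by rewrite sumr_const card_ord.
rewrite (bigD1 l)//= big1 ?addr0// => m ml.
by have := Aw m; rewrite /A (negbTE ml).
Qed.

(** On the event [N = 1], which is independent of the first summand, the random
    sum is that summand. *)
Lemma summand_nat :
  P (N @^-1` [set 1%N]) != 0%E -> iid X -> independent_of_family P N X ->
  (forall l, P (random_sum N X l @^-1` [set x | x \isn't a Num.nat]) = 0%E) ->
  forall l, P [set w | tnth (X 0%N w) l \isn't a Num.nat] = 0%E.
Proof.
move=> N1 hiid hindep Snat l.
pose B := [set x : k.-tuple R | tnth x l \isn't a Num.nat].
have mB : measurable B.
  rewrite -[B]setTI.
  exact: (measurable_tnth l measurableT measurable_nonnat_set).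
have joint := joint_law_count_sample (n := 1) (B := fun=> B) hiid hindep
  (fun=> mB).
suff joint0 : P [set w | N w = 1%N /\ forall i : 'I_1, B (X i w)] = 0%E.
  move: joint; rewrite big_ord1 joint0 => /esym/eqP.
  by rewrite mule_eq0 (negbTE N1) => /eqP.
apply: subset_measure0 (Snat l).
- exact: (measurable_count_sample (B := fun=> B) (fun=> mB)).
- rewrite -[X in measurable X]setTI.
  by apply: measurable_random_sum => //; exact: measurable_nonnat_set.
- by move=> w [Nw /(_ ord0)] /=; rewrite /random_sum Nw big_ord1.
Qed.

Lemma std_basis_law_total (Y : {RV P >-> k.-tuple R}) :
  P [set w | exists l, Y w = std_basis l] =
  (\sum_l distribution P Y [set std_basis l])%E.
Proof.
rewrite (@measure_exists _ _ _ _ (fun l => Y @^-1` [set std_basis l]))//.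
  by move=> l; apply: measurable_funPTI; exact: measurable_tuple_set1.
by move=> i j w /= -> /std_basis_inj.
Qed.

End RandomSums.

(** * Almost sure statements and categorical laws *)

Section AlmostSure.
Context {d : measure_display} {T : measurableType d} {R : realType}.
Context {P : probability T R}.

Lemma probability1_ae {A : set T} : measurable A ->
  P A = 1%E <-> {ae P, forall w, A w}.
Proof.
move=> mA; have mCA := measurableC mA.
split => [PA1|/(measure_negligible mCA) PA0].
  suff : P (~` A) = 0%E by move=> PA0; exact/(negligibleP P mCA).
  by rewrite probability_setC// PA1 subee.
by rewrite -[A]setCK probability_setC// PA0 sube0.
Qed.

Lemma le_measure_ae {A B : set T} : measurable A -> measurable B ->
  {ae P, forall w, A w -> B w} -> (P A <= P B)%E.
Proof.
move=> mA mB [Z [mZ Z0 ABZ]].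
rewrite -(measureU0 mB mZ Z0); apply: le_measure; rewrite ?inE//.
  exact: measurableU.
move=> w Aw; have [Bw|nBw] := pselect (B w); first by left.
by right; apply: ABZ => /= /(_ Aw).
Qed.

Lemma eq_measure_ae {A B : set T} : measurable A -> measurable B ->
  {ae P, forall w, A w <-> B w} -> P A = P B.
Proof.
move=> mA mB AB; apply/eqP; rewrite eq_le !le_measure_ae//.
- by apply: filterS AB => w [].
- by apply: filterS AB => w [].
Qed.

Context {k : nat}.

(** A law is categorical exactly when the basis vectors carry total mass one, the
    probabilities being their masses; this equivalence moves between that condition
    on the law and almost sure statements about the vector. *)
Lemma categorical_ae (Y : {RV P >-> k.-tuple R}) :
  (\sum_l distribution P Y [set std_basis l])%E = 1%E <->
  {ae P, forall w, exists l, Y w = std_basis l}.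
Proof.
rewrite -std_basis_law_total; apply: probability1_ae.
apply: (measurable_exists (F := fun l => Y @^-1` [set std_basis l])) => l.
by apply: measurable_funPTI; exact: measurable_tuple_set1.
Qed.

Lemma categorical_of_nat (Y : {RV P >-> k.-tuple R}) :
  {ae P, forall w, \sum_(l < k) tnth (Y w) l = 1} ->
  (forall l, P [set w | tnth (Y w) l \isn't a Num.nat] = 0%E) ->
  exists p, categorical_law Y p.
Proof.
move=> sumY natY.
have mY l : measurable [set w | tnth (Y w) l \isn't a Num.nat].
  rewrite -[X in measurable X]setTI.
  exact: (measurableT_comp (measurable_tnth l) (measurable_funPT Y)
    measurableT measurable_nonnat_set).
have basisY : {ae P, forall w, exists l, Y w = std_basis l}.
  have : {ae P, forall w, forall l, tnth (Y w) l \is a Num.nat}.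
    apply: filter_forall => l; exists [set w | tnth (Y w) l \isn't a Num.nat].
    by split=> // w /= /negP.
  by apply: filterS2 sumY => w sumw natw; exact: nat_tuple_sum1.
pose p l := fine (distribution P Y [set std_basis l]).
have pE l : distribution P Y [set std_basis l] = (p l)%:E.
  rewrite fineK// fin_num_measure//.
  exact: measurable_tuple_set1.
exists p; split => //; split => [l|]; first exact: fine_ge0.
apply: EFin_inj; rewrite -sumEFin.
by under eq_bigr do rewrite -pE; exact/categorical_ae.
Qed.

Lemma categorical_sample_ae {X : nat -> {RV P >-> k.-tuple R}}
    {p : 'I_k -> R} :
  identically_distributed X -> categorical_law (X 0%N) p ->
  {ae P, forall w, forall i, exists l, X i w = std_basis l}.
Proof.
move=> idX [[_ sump] lawX]; apply: ae_foralln => i; apply/categorical_ae.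
rewrite -(congr1 EFin sump) -sumEFin; apply: eq_bigr => l _.
by rewrite (idX i 0%N) ?lawX//; exact: measurable_tuple_set1.
Qed.

End AlmostSure.

(** * Counting a sample with two types *)

Section Thinning.
Context {k : nat} (l m : 'I_k) (lm : l != m).

Definition two_types {n : nat} (J : {set 'I_n}) (i : 'I_n) : 'I_k :=
  if i \in J then m else l.

Lemma card_notin_draw {a b : nat} {J : {set 'I_(a + b)}} :
  #|J| = b -> #|[predC J]| = a.
Proof.
move=> Jb; apply/eqP; rewrite -(eqn_add2l b); have := cardC (mem J).
by rewrite card_ord Jb [RHS]addnC => /eqP.
Qed.

Lemma two_types_inj {n : nat} : injective (fun J : {set 'I_n} => two_types J).
Proof.
move=> J K JK; apply/setP => i; have := congr1 (fun c => c i) JK.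
rewrite /two_types; move: lm; rewrite eq_sym.
by case: ifP; case: ifP => // _ _ /negP nlm /eqP; last rewrite eq_sym.
Qed.

(** The occupation numbers [a] for [l], [b] for [m] and [0] elsewhere fix the
    sample size, as they add up to it, and then amount to choosing which [b]
    positions carry [m]. *)
Lemma occupation_two_types (a b M : nat) (g : nat -> 'I_k) :
  (forall j, \sum_(i < M) (g i == j) = a * (l == j) + b * (m == j))%N <->
  M = (a + b)%N /\ exists J : {set 'I_(a + b)},
    #|J| == b /\ forall i : 'I_(a + b), g i = two_types J i.
Proof.
split => [occ|[-> [J [/eqP Jb gJ]] j]].
  have Mab : M = (a + b)%N.
    have sum_eq (j : 'I_k) : (\sum_i (j == i) = 1)%N.
      by rewrite (bigD1 j)//= eqxx big1// => i; rewrite eq_sym => /negbTE ->.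
    transitivity (\sum_j \sum_(i < M) (g i == j))%N.
      rewrite exchange_big/=; under eq_bigr do rewrite sum_eq.
      by rewrite sum1_card card_ord.
    under eq_bigr do rewrite occ.
    by rewrite big_split/= -!big_distrr/= !sum_eq !muln1.
  subst M; split => //; exists [set i : 'I_(a + b) | g i == m]%SET; split.
    rewrite -sum1_card big_mkcond/=; apply/eqP.
    have := occ m; rewrite eqxx (negbTE lm) muln0 add0n muln1 => occm.
    by rewrite -[RHS]occm; apply: eq_bigr => i _; rewrite inE; case: eqP.
  move=> i; rewrite /two_types inE; case: eqVneq => [//|gm].
  apply/eqP; apply: contraT => gl; have := occ (g i).
  rewrite [l == _]eq_sym [m == _]eq_sym (negbTE gm) (negbTE gl) !muln0 => /eqP.
  by rewrite sum_nat_eq0 => /forallP/(_ i); rewrite eqxx.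
under eq_bigr do rewrite gJ.
rewrite (bigID (mem J))/= addnC; congr (_ + _)%N.
  rewrite (eq_bigr (fun=> (l == j) : nat)); last first.
    by move=> i /negbTE iJ; rewrite /two_types iJ.
  by rewrite sum_nat_const; congr (_ * _)%N; exact: card_notin_draw.
rewrite (eq_bigr (fun=> (m == j) : nat)); last first.
  by move=> i iJ; rewrite /two_types iJ.
by rewrite sum_nat_const Jb.
Qed.

End Thinning.

Section Counts.
Context {d : measure_display} {T : measurableType d} {R : realType}.
Context {P : probability T R} {k : nat}.
Context {N : {RV P >-> nat}} {X : nat -> {RV P >-> k.-tuple R}}.

Lemma random_sum_std_basis {w : T} {g : nat -> 'I_k} (j : 'I_k) :
  (forall i, X i w = std_basis (g i)) ->
  random_sum N X j w = (\sum_(i < N w) (g i == j))%:R.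
Proof.
move=> Xg; rewrite /random_sum natr_sum; apply: eq_bigr => i _.
by rewrite Xg tnth_mktuple eq_sym.
Qed.

(** Almost surely every term is a basis vector, so that the event is the disjoint
    union, over the ['C(a + b, b)] sets of positions occupied by type [m], of events
    of the same probability. *)
Lemma two_type_count_law (p : 'I_k -> R) (l m : 'I_k) (a b : nat) : l != m ->
  iid X -> independent_of_family P N X -> categorical_law (X 0%N) p ->
  P [set w | forall j, random_sum N X j w = (a * (l == j) + b * (m == j))%:R] =
  (P (N @^-1` [set (a + b)%N]) *
   ('C(a + b, b)%:R * (p l ^+ a * p m ^+ b))%:E)%E.
Proof.
move=> lm hiid hindep lawX; have [_ idX] := hiid.
pose C J := [set w | N w = (a + b)%N /\ forall i : 'I_(a + b),
  [set std_basis (two_types l m J i)] (X i w)].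
have mC J : measurable (C J).
  exact: (measurable_count_sample
    (B := fun i => [set std_basis (two_types l m J i)])
    (fun=> measurable_tuple_set1 _)).
(* Sets of the wrong size index empty pieces of the union. *)
pose F (J : {set 'I_(a + b)}) := [set w | #|J| == b /\ C J w].
have mF J : measurable (F J).
  rewrite /F; case: (#|J| == b).
    by rewrite (_ : [set w | _] = C J)//; apply/seteqP; split => w // [].
  by rewrite (_ : [set w | _] = set0)//; apply/seteqP; split => w // [].
have mS : measurable
    [set w | forall j, random_sum N X j w = (a * (l == j) + b * (m == j))%:R].
  apply: (measurable_forall (F := fun j => [set w | random_sum N X j w =
    (a * (l == j) + b * (m == j))%:R])) => j.
  rewrite -[X in measurable X]setTI.
  exact: (measurable_random_sum N X j measurableT (measurable_set1 _)).
rewrite (eq_measure_ae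
  (B := [set w | exists J : {set 'I_(a + b)}, F J w]) mS); last first.
- apply: filterS (categorical_sample_ae idX lawX) => w /choice[g Xg].
  apply: (@iff_trans _
      (forall j, \sum_(i < N w) (g i == j) = a * (l == j) + b * (m == j))%N).
    by split => occ j; have := occ j; rewrite (random_sum_std_basis _ Xg);
      [move/eqP; rewrite eqr_nat => /eqP|move=> ->].
  apply: (iff_trans (occupation_two_types lm _ _ _ _)); split.
    move=> [Nw [J [Jb gJ]]]; exists J; split => //; split => // i.
    by rewrite /= Xg gJ.
  move=> [J [Jb [Nw XJ]]]; split => //; exists J; split => // i.
  by apply: (@std_basis_inj R k); rewrite -Xg XJ.
- exact: measurable_exists.
rewrite measure_exists//; last first.
  move=> J K w [_ [_ XJ]] [_ [_ XK]]; apply: (two_types_inj lm).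
  by apply/funext => i; apply: (@std_basis_inj R k); rewrite -XJ XK.
have PF J : P (F J) = (if #|J| == b then P (N @^-1` [set (a + b)%N]) *
    (p l ^+ a * p m ^+ b)%:E else 0)%E.
  rewrite /F; case: ifPn => [/eqP Jb|_]; last first.
    rewrite (_ : [set w | _] = set0) ?measure0//.
    by apply/seteqP; split => w // [].
  rewrite (_ : [set w | _] = C J); last by apply/seteqP; split => w // [].
  rewrite (joint_law_count_sample
    (B := fun i => [set std_basis (two_types l m J i)]) hiid hindep
    (fun=> measurable_tuple_set1 _)).
  under eq_bigr => i _.
    rewrite (lawX.2 (two_types l m J i) :
      P (X 0%N @^-1` [set std_basis _]) = _); over.
  rewrite prodEFin; congr (_ * _%:E)%E.
  rewrite (bigID (mem J))/= mulrC; congr (_ * _).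
    rewrite (eq_bigr (fun=> p l)); last first.
      by move=> i /negbTE iJ; rewrite /two_types iJ.
    by rewrite prodr_const; congr (_ ^+ _); exact: card_notin_draw.
  rewrite (eq_bigr (fun=> p m)); last first.
    by move=> i iJ; rewrite /two_types iJ.
  by rewrite prodr_const Jb.
rewrite (eq_bigr _ (fun J _ => PF J)) -big_mkcond/=.
have : P (N @^-1` [set (a + b)%N]) \is a fin_num.
  by apply: fin_num_measure; exact: measurable_funPTI.
move=> /fineK <-; rewrite -EFinM sumEFin sumr_const.
have <- : #|[set J : {set 'I_(a + b)} | #|J| == b]%SET| = 'C(a + b, b).
  by rewrite card_draws card_ord.
by rewrite cardsE -EFinM [in RHS]mulr_natl mulrnAr.
Qed.

(** Independence turns the two-type event into a product in which only the factor
    of [l] depends on [a]. That of [m] depends on [b], and the remaining ones,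
    where the count is [0], are constants absorbed by [G]. *)
Lemma thinned_count_factorizes (p : 'I_k -> R) (l m : 'I_k) : l != m ->
  iid X -> independent_of_family P N X -> categorical_law (X 0%N) p ->
  mutually_independent P (random_sum N X) ->
  exists F G : nat -> R, (forall b, 0 <= G b) /\ forall a b,
    fine (P (N @^-1` [set (a + b)%N])) *
      ('C(a + b, b)%:R * (p l ^+ a * p m ^+ b)) = F a * G b.
Proof.
move=> lm hiid hindep lawX hS.
pose s j (a : nat) := fine (P (random_sum N X j @^-1` [set a%:R])).
have sE j a : P (random_sum N X j @^-1` [set a%:R]) = (s j a)%:E.
  rewrite fineK// fin_num_measure// -[X in measurable X]setTI.
  exact: (measurable_random_sum N X j measurableT (measurable_set1 _)).
exists (s l), (fun b => s m b * \prod_(j | (j != l) && (j != m)) s j 0%N).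
split=> [b|a b].
  by rewrite mulr_ge0 ?fine_ge0// prodr_ge0// => j _; rewrite fine_ge0.
apply: EFin_inj; rewrite EFinM fineK; last first.
  by apply: fin_num_measure; exact: measurable_funPTI.
rewrite -(two_type_count_law a b lm hiid hindep lawX).
rewrite (mutually_independent_all hS
  (A := fun j => [set (a * (l == j) + b * (m == j))%:R : R]))//.
rewrite (eq_bigr (fun j => (s j (a * (l == j) + b * (m == j))%N)%:E)); last first.
  by move=> j _; exact: sE.
have ml : m != l by rewrite eq_sym.
rewrite prodEFin (bigD1 l)//= (bigD1 m)//=.
rewrite !eqxx (negbTE lm) (negbTE ml) !muln0 !muln1 addn0 add0n.
congr (_ * (_ * _))%:E; apply: eq_bigr => j /andP[/negbTE jl /negbTE jm].
by rewrite [l == j]eq_sym [m == j]eq_sym jl jm !muln0.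
Qed.

End Counts.

(** * Recognising the Poisson law *)

(** Both measures have total mass [1], which is the sum of their point masses. *)
Lemma proportional_probability {R : realType} (mu nu : probability nat R)
    (c : R) :
  0 <= c -> (forall n, mu [set n] = c%:E * nu [set n])%E -> c = 1.
Proof.
have total (rho : probability nat R) : (\sum_(n <oo) rho [set n])%E = 1%E.
  rewrite -(probability_setT rho) -[X in _ = rho X]image_id -bigcup_imset1.
  rewrite measure_bigcup//; first by apply: eq_eseriesl => n; rewrite in_setT.
  by move=> i j _ _ [n [/= <- <-]].
move=> c0 munu; apply: EFin_inj.
rewrite -[RHS](total mu) -[LHS]mule1 -(total nu).
under [in RHS]eq_eseriesr do rewrite munu.
by rewrite nneseriesZl.
Qed.

Section Poisson.
Context {d : measure_display} {T : measurableType d} {R : realType}.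
Context {P : probability T R} {N : {RV P >-> nat}}.

(** The recursion makes the law of [N] proportional to [lambda^n / n!], hence, when
    [lambda > 0], to the Poisson law. For [lambda = 0] it would concentrate [N]
    at [0]. *)
Lemma poisson_of_recursion (lambda : R) :
  P (N @^-1` [set 0%N]) != 1%E -> 0 <= lambda ->
  (forall n, P (N @^-1` [set n.+1]) * n.+1%:R%:E =
     lambda%:E * P (N @^-1` [set n]))%E ->
  0 < lambda /\ poisson_law N lambda.
Proof.
pose q n := fine (P (N @^-1` [set n])).
have qE n : P (N @^-1` [set n]) = (q n)%:E.
  by rewrite fineK// fin_num_measure//; exact: measurable_funPTI.
move=> N0 lambda0 rec.
have qS n : q n.+1 = lambda * q n / n.+1%:R.
  have := rec n; rewrite !qE -!EFinM => -[<-].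
  by rewrite mulfK// pnatr_eq0.
have qn n : q n = q 0%N * (lambda ^+ n / n`!%:R).
  elim: n => [|n IHn]; first by rewrite expr0 fact0 divr1 mulr1.
  rewrite qS IHn factS natrM exprS; field.
  by rewrite -mulrS !pnatr_eq0 -lt0n fact_gt0.
have lambda_gt0 : 0 < lambda.
  rewrite lt_neqAle lambda0 andbT eq_sym; apply: contra N0 => /eqP lambda_eq0.
  rewrite qE; apply/eqP; congr (_%:E).
  apply: (@proportional_probability _ (distribution P N) (dirac 0%N)).
    exact: fine_ge0.
  move=> n; rewrite [LHS]qE qn lambda_eq0 /= diracE classical_sets.in_set1.
  by case: n => [|n]; rewrite ?expr0 ?fact0 ?divr1 ?expr0n/= ?mul0r -?EFinM.
split => //.
pose nu : probability nat R := poisson_prob lambda 0%N.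
have nuE n : nu [set n] = (poisson_pmf lambda n)%:E.
  rewrite /nu/= /poisson_prob lambda_gt0 esum_set1//.
  by rewrite lee_fin poisson_pmf_ge0.
have pmfE n : q n = q 0%N * expR lambda * poisson_pmf lambda n.
  rewrite /poisson_pmf lambda_gt0 qn expRN; field.
  by rewrite pnatr_eq0 -lt0n fact_gt0 gt_eqF ?expR_gt0.
have q01 : q 0%N * expR lambda = 1.
  apply: (@proportional_probability _ (distribution P N) nu).
    by rewrite mulr_ge0 ?fine_ge0 ?expR_ge0.
  by move=> n; rewrite [LHS]qE nuE pmfE EFinM.
by move=> n; rewrite [LHS]qE pmfE q01 mul1r.
Qed.

(** With [b = 0] and [b = 1] the factorization gives
    [P(N = n) p^n = F n * G 0] and [(n + 1) P(N = n + 1) p^n r = F n * G 1], and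
    eliminating [F n] leaves the Poisson recursion. If [G 0] were zero, the first
    identity would make every [P(N = n)] zero. *)
Lemma poisson_of_factorization (p r : R) (F G : nat -> R) :
  0 < p -> 0 < r -> (forall b, 0 <= G b) ->
  P (N @^-1` [set 0%N]) != 1%E ->
  (forall a b, fine (P (N @^-1` [set (a + b)%N])) *
      ('C(a + b, b)%:R * (p ^+ a * r ^+ b)) = F a * G b) ->
  exists lambda, 0 < lambda /\ poisson_law N lambda.
Proof.
move=> p0 r0 G0 N0 fact; pose q n := fine (P (N @^-1` [set n])).
have qE n : P (N @^-1` [set n]) = (q n)%:E.
  by rewrite fineK// fin_num_measure//; exact: measurable_funPTI.
have pn0 a : p ^+ a != 0 by rewrite expf_neq0 ?gt_eqF.
have F0 a : q a * p ^+ a = F a * G 0%N.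
  by rewrite -fact addn0 bin0 mul1r expr0 mulr1.
have F1 a : q a.+1 * (a.+1%:R * (p ^+ a * r)) = F a * G 1%N.
  by rewrite -fact addn1 bin1 expr1.
have G0_neq0 : G 0%N != 0.
  (* If [G 0] vanished, the law of [N] would be [0] times any other law. *)
  apply/eqP => G00; have /eqP : (0 : R) = 1.
    apply: (@proportional_probability _ (distribution P N) (dirac 0%N)) => // n.
    rewrite mul0e [LHS]qE; congr (_%:E); apply: (mulIf (pn0 n)).
    by rewrite F0 G00 mulr0 mul0r.
  by rewrite eq_sym oner_eq0.
exists (G 1%N / (r * G 0%N)); apply: poisson_of_recursion => // [|n].
  by rewrite divr_ge0 ?mulr_ge0 ?(ltW r0).
rewrite !qE -!EFinM; congr (_%:E).
apply: (mulIf (pn0 n)); apply: (mulIf G0_neq0).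
have r_neq0 : r != 0 by rewrite gt_eqF.
transitivity (F n * G 1%N * G 0%N / r); first by rewrite -F1; field.
by rewrite [X in X / r]mulrAC -F0; field; rewrite G0_neq0.
Qed.

End Poisson.

Theorem theorem5p1 (d : measure_display) (T : measurableType d) (R : realType)
    (P : probability T R) (k : nat)
    (N : {RV P >-> nat}) (X : nat -> {RV P >-> k.-tuple R})
    (hN0 : (P [set w | N w = 0%N] < 1)%E)
    (hiid : iid X)
    (hmean : forall (i : nat) (l : 'I_k),
      P.-integrable setT (fun w => (tnth (X i w) l)%:E))
    (hindep : independent_of_family P N X)
    (hsum : forall i : nat, {ae P, forall w, \sum_(l < k) tnth (X i w) l = 1})
    (hS : mutually_independent P (random_sum N X)) :
  (forall p : 'I_k -> R,
      categorical_law (X 0%N) p -> (exists l, 0 < p l < 1) ->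
      exists lambda : R, 0 < lambda /\ poisson_law N lambda) /\
  (forall lambda : R, 0 < lambda -> poisson_law N lambda ->
      exists p : 'I_k -> R, categorical_law (X 0%N) p).
Proof.
split=> [p lawX [l /andP[pl0 pl1]]|lambda lambda0 lawN].
  have [m lm pm0] : exists2 m, l != m & 0 < p m.
    have [[p_ge0 sump] _] := lawX; apply: contrapT => nom.
    move: pl1; rewrite -sump (bigD1 l)//= big1 ?addr0 ?ltxx// => m ml.
    apply/eqP; rewrite eq_le p_ge0 andbT leNgt; apply/negP => pm0.
    by apply: nom; exists m => //; rewrite eq_sym.
  have [F [G [G0 fact]]] := thinned_count_factorizes lm hiid hindep lawX hS.
  by apply: (poisson_of_factorization pl0 pm0 G0 _ fact); rewrite lt_eqF.
have N_neq0 n : P (N @^-1` [set n]) != 0%E.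
  rewrite (lawN n : P (N @^-1` [set n]) = _) /poisson_pmf lambda0.
  by rewrite eqe !mulf_neq0 ?invr_neq0 ?expf_neq0 ?gt_eqF ?expR_gt0//.
apply: categorical_of_nat (hsum 0%N) _.
apply: summand_nat => //; exact: random_sum_nat.
Qed.
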